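(* Let $(S,=,\#,\cdot)$ be a semigroup with apartness, $\mu$ a congruence and $\kappa$ a co-congruence on $S$. (i) $\kappa$ defines an apartness on the factor set $S/\mu$ if and only if $\mu\cap\kappa=\emptyset$. (ii) If $\mu\cap\kappa=\emptyset$ and $S/\mu$ is equipped with the apartness defined by $\kappa$ and the multiplication $x\mu\cdot y\mu=(xy)\mu$, then the quotient map $\pi:S\to S/\mu$, $\pi(x)=x\mu$, is an se-epimorphism.
   Context: Constructive (Bishop-style) setting. A set with apartness: inhabited set with equality $=$ (an equivalence) and $\#$ with $\neg(x\#x)$, $x\#y\Rightarrow y\#x$, $x\#z\Rightarrow\forall y(x\#y\vee y\#z)$; an apartness is extensional w.r.t. equality. A semigroup with apartness is a set with apartness with an associative operation satisfying $ax\#by\Rightarrow(a\#b\vee x\#y)$. A congruence is an equivalence $\mu$ (w.r.t. $=$) with $(x,y),(s,t)\in\mu\Rightarrow(xs,yt)\in\mu$; $S/\mu$ has equality $x\mu=y\mu\iff(x,y)\in\mu$. A co-congruence is a symmetric relation $\kappa$ that is strongly irreflexive ($(x,y)\in\kappa\Rightarrow x\#y$), co-transitive ($(x,y)\in\kappa\Rightarrow\forall z((x,z)\in\kappa\vee(z,y)\in\kappa)$) and co-compatible ($(xz,yt)\in\kappa\Rightarrow(x,y)\in\kappa\vee(z,t)\in\kappa$). $\kappa$ defines an apartness on $S/\mu$ if $x\mu\#y\mu:\iff(x,y)\in\kappa$ gives an apartness on $(S/\mu,=)$. An se-epimorphism is a surjective homomorphism $f$ with $f(x)\#f(y)\Rightarrow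 x\#y$. *)

(* Defs.v *)
From Stdlib Require Export Relation_Definitions RelationClasses Morphisms Setoid.

(* Bishop-style sets are types with an explicit equality; the constructive
   connectives are those of Prop, and no classical axiom is used. *)

Record is_apartness (A : Type) (eq ap : relation A) : Prop := {
  ap_irrefl : forall x, ~ ap x x;
  ap_sym : forall x y, ap x y -> ap y x;
  ap_cotrans : forall x z, ap x z -> forall y, ap x y \/ ap y z;
  ap_ext : Proper (eq ==> eq ==> iff) ap
}.

Record is_set_with_apartness (A : Type) (eq ap : relation A) : Prop := {
  set_inhabited : inhabited A;
  set_eq_equiv : Equivalence eq;
  set_ap : is_apartness A eq ap
}.

(* Raw signature (S, =, #, .) without axioms. *)
Record ap_magma : Type := ApMagma {
  carrier :> Type;
  eqv : relation carrier;
  apart : relation carrier;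
  mul : carrier -> carrier -> carrier
}.

Arguments eqv {_} _ _.
Arguments apart {_} _ _.
Arguments mul {_} _ _.

Declare Scope ap_scope.
Delimit Scope ap_scope with ap.
Infix "==" := eqv (at level 70, no associativity) : ap_scope.
Infix "#" := apart (at level 70, no associativity) : ap_scope.
Infix "*" := mul : ap_scope.
Local Open Scope ap_scope.

(* [mul_ext] says that the operation is a function with respect to [==]; it does
   not follow from [mul_se], as the apartness is not assumed to be tight. *)
Record is_semigroup_with_apartness (S : ap_magma) : Prop := {
  sg_set : is_set_with_apartness S eqv apart;
  mul_ext : Proper (eqv ==> eqv ==> eqv) (@mul S);
  mul_assoc : forall x y z : S, (x * y) * z == x * (y * z);
  mul_se : forall a b x y : S, a * x # b * y -> a # b \/ x # y
}.

(* As a subset of S x S, a congruence has to respect the equality of S. *)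
Record congruence (S : ap_magma) (mu : relation S) : Prop := {
  cong_ext : Proper (eqv ==> eqv ==> iff) mu;
  cong_equiv : Equivalence mu;
  cong_compat : forall x y s t : S, mu x y -> mu s t -> mu (x * s) (y * t)
}.

(* Here extensionality with respect to [==] need not be required: it follows from
   strong irreflexivity and co-transitivity. *)
Record co_congruence (S : ap_magma) (kappa : relation S) : Prop := {
  cocong_sym : forall x y : S, kappa x y -> kappa y x;
  cocong_strong_irrefl : forall x y : S, kappa x y -> x # y;
  cocong_cotrans :
    forall x y : S, kappa x y -> forall z, kappa x z \/ kappa z y;
  cocong_cocompat :
    forall x y z t : S, kappa (x * z) (y * t) -> kappa x y \/ kappa z t
}.

(* The factor set S/mu: its elements are the formal classes [coset mu x], compared
   through their representatives. *)
Record factor_set (A : Type) (mu : relation A) : Type := coset { repr : A }.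

Arguments factor_set {A} mu.
Arguments coset {A} mu repr.
Arguments repr {A mu} _.

Definition factor_eq {A : Type} (mu : relation A) : relation (factor_set mu) :=
  fun p q => mu (repr p) (repr q).

(* Only a relation on representatives: that it respects [factor_eq mu] is part
   of its being an apartness. *)
Definition factor_apart {A : Type} (mu kappa : relation A) :
    relation (factor_set mu) :=
  fun p q => kappa (repr p) (repr q).

Definition factor_mul (S : ap_magma) (mu : relation S) :
    factor_set mu -> factor_set mu -> factor_set mu :=
  fun p q => coset mu (repr p * repr q).

Definition factor (S : ap_magma) (mu kappa : relation S) : ap_magma :=
  ApMagma (factor_set mu) (factor_eq mu) (factor_apart mu kappa)
    (factor_mul S mu).

Definition quotient_map (S : ap_magma) (mu kappa : relation S) :
    S -> factor S mu kappa :=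
  fun x => coset mu x.

Definition defines_apartness (A : Type) (mu kappa : relation A) : Prop :=
  is_apartness (factor_set mu) (factor_eq mu) (factor_apart mu kappa).

Definition disjoint_relations (A : Type) (mu kappa : relation A) : Prop :=
  forall x y : A, ~ (mu x y /\ kappa x y).

Record homomorphism (S T : ap_magma) (f : S -> T) : Prop := {
  hom_ext : Proper (eqv ==> eqv) f;
  hom_mul : forall x y : S, f (x * y) == f x * f y
}.

Record se_epimorphism (S T : ap_magma) (f : S -> T) : Prop := {
  se_hom : homomorphism S T f;
  se_surj : forall y : T, exists x : S, y == f x;
  se_ext : forall x y : S, f x # f y -> x # y
}.

(* Main.v *)
(** Co-transitivity applied twice moves [kappa x y] to [kappa x' y'] along
    [mu x x'] and [mu y y']: the two alternatives to discard are pairs lying in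
    both [mu] and [kappa].  Conversely, extensionality turns a pair common to
    [mu] and [kappa] into an instance of [kappa y y]. *)

Require Import Defs.

Local Open Scope ap_scope.

Lemma cotransitive_disjoint_ext (A : Type) (mu kappa : relation A) :
  (forall x y, kappa x y -> kappa y x) ->
  (forall x y, kappa x y -> forall z, kappa x z \/ kappa z y) ->
  disjoint_relations A mu kappa ->
  forall x x' y y', mu x x' -> mu y y' -> kappa x y -> kappa x' y'.
Proof.
  intros sym cotrans disj x x' y y' Hx Hy Hxy.
  destruct (cotrans _ _ Hxy x') as [H | H]; [now destruct (disj x x') |].
  destruct (cotrans _ _ H y') as [H' | H']; [exact H' |].
  destruct (disj y y'); auto.
Qed.

(** Irreflexivity, symmetry and co-transitivity pass from [kappa] to classes directly; disjointness
    enters through extensionality. *)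
Lemma defines_apartness_iff_disjoint (S : ap_magma) (mu kappa : relation S) :
  is_apartness S eqv apart -> Equivalence mu -> co_congruence S kappa ->
  defines_apartness S mu kappa <-> disjoint_relations S mu kappa.
Proof.
  intros Hap Hmu [sym irrefl cotrans _]; split.
  - intros [ap_irr _ _ ext] x y [Hxy Kxy].
    apply (ap_irr (coset mu y)).
    apply (ext (coset mu x) (coset mu y) Hxy (coset mu y) (coset mu y));
      [unfold factor_eq; reflexivity | exact Kxy].
  - intros disj; split.
    + intros p Hp; exact (ap_irrefl _ _ _ Hap _ (irrefl _ _ Hp)).
    + intros p q; apply sym.
    + intros p q Hpq r; exact (cotrans _ _ Hpq (repr r)).
    + intros p p' Hp q q' Hq; unfold factor_eq in Hp, Hq.
      (* The backward implication is the same transport, along the reversed [mu]-pairs. *)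
      split; apply (cotransitive_disjoint_ext S mu kappa); auto;
        now symmetry.
Qed.

(** Extensionality moves the second entry of [mu x x] along [x == y]. Thus laws holding in [S] up to
    [==] descend to classes. *)
Lemma congruence_of_eqv (S : ap_magma) (mu : relation S) :
  Equivalence (@eqv S) -> congruence S mu ->
  forall x y : S, x == y -> mu x y.
Proof.
  intros Heq [ext equiv _] x y Hxy.
  apply (ext x x (reflexivity x) x y Hxy); reflexivity.
Qed.

(** This makes the factor a legitimate codomain for the quotient map. Co-compatibility of [kappa] is
    exactly [mul_se] read on representatives. *)
Lemma factor_is_semigroup_with_apartness (S : ap_magma) (mu kappa : relation S) :
  is_semigroup_with_apartness S -> congruence S mu -> co_congruence S kappa ->
  disjoint_relations S mu kappa ->
  is_semigroup_with_apartness (factor S mu kappa).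
Proof.
  intros [[[s] Heq Hap] _ assoc _] Hmu Hkappa disj.
  pose proof (cong_equiv _ _ Hmu) as equiv.
  split.
  - split.
    + exact (inhabits (coset mu s)).
    + split.
      * intros p; change (mu (repr p) (repr p)); reflexivity.
      * intros p q Hpq; change (mu (repr q) (repr p)); symmetry; exact Hpq.
      * intros p q r Hpq Hqr; change (mu (repr p) (repr r)).
        transitivity (repr q); assumption.
    + now apply defines_apartness_iff_disjoint.
  - intros p p' Hp q q' Hq; exact (cong_compat _ _ Hmu _ _ _ _ Hp Hq).
  - intros p q r; apply (congruence_of_eqv S mu Heq Hmu), assoc.
  - intros a b x y; apply (cocong_cocompat _ _ Hkappa).
Qed.

Lemma quotient_map_se_epimorphism (S : ap_magma) (mu kappa : relation S) :
  Equivalence (@eqv S) -> congruence S mu -> co_congruence S kappa ->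
  se_epimorphism S (factor S mu kappa) (quotient_map S mu kappa).
Proof.
  intros Heq Hmu Hkappa.
  pose proof (cong_equiv _ _ Hmu) as equiv.
  split.
  - split.
    + intros x y; apply (congruence_of_eqv S mu Heq Hmu).
    + intros x y; change (mu (x * y) (x * y)); reflexivity.
  (* A formal class carries its representative, so a preimage is found without choice. *)
  - intros p; exists (repr p); change (mu (repr p) (repr p)); reflexivity.
  (* Apartness of the images of [x] and [y] unfolds to [kappa x y]. *)
  - intros x y; apply (cocong_strong_irrefl _ _ Hkappa).
Qed.

Theorem theorem23 (S : ap_magma) (mu kappa : relation S)
    (HS : is_semigroup_with_apartness S)
    (Hmu : congruence S mu) (Hkappa : co_congruence S kappa) :
  (defines_apartness S mu kappa <-> disjoint_relations S mu kappa) /\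
  (disjoint_relations S mu kappa ->
     is_semigroup_with_apartness (factor S mu kappa) /\
     se_epimorphism S (factor S mu kappa) (quotient_map S mu kappa)).
Proof.
  destruct (sg_set _ HS) as [_ Heq Hap].
  split.
  - apply defines_apartness_iff_disjoint; trivial.
    exact (cong_equiv _ _ Hmu).
  - intros disj; split.
    + now apply factor_is_semigroup_with_apartness.
    + now apply quotient_map_se_epimorphism.
Qed.
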